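(* Let $G$ be a graph on $n$ vertices. Then $$\dim_2^S(G)=\begin{cases}\dim_2^E(G) & \text{if } \mathcal R(G)<\infty,\\ n-1 & \text{if } \mathcal R(G)=\infty.\end{cases}$$
   Context: All graphs are finite and simple. A Euclidean representation of a graph $G$ in $\mathbb R^d$ (as a two-distance set) is an injective map $f:V(G)\to\mathbb R^d$ for which there are real numbers $b\ge a>0$ with $\|f(u)-f(v)\|=a$ if $uv$ is an edge of $G$ and $\|f(u)-f(v)\|=b$ if $u\ne v$ and $uv$ is not an edge. The number $\dim_2^E(G)$ is the smallest $d$ such that $G$ has a Euclidean representation in $\mathbb R^d$. Such a representation is spherical if $f(V(G))$ lies on a $(d-1)$-dimensional sphere (of some radius) in $\mathbb R^d$; $\dim_2^S(G)$ is the smallest $d$ such that $G$ has a spherical representation in $\mathbb R^d$. For $G$ with vertices $v_1,\dots,v_n$ let $D_G(t)$ be the symmetric $n\times n$ matrix with zero diagonal whose $(i,j)$ entry ($i\neq j$) is $1$ if $v_iv_j$ is an edge and $t$ otherwise. Put $M_G(t)=\det D_G(t)$ and let $C_G(t)=\det\begin{pmatrix}0&\mathbf 1^T\\ \mathbf 1&D_G(t)\end{pmatrix}$, where $\mathbf 1$ is the all-ones column of length $n$. Let $F_G(t)=-\frac12\,\frac{M_G(t)}{C_G(t)}$, viewed as a rational function (common factors cancelled; $F_G(t_0)<\infty$ means that $t_0$ is not a pole). Let $\tau_1(G)$ be the smallest real root of $C_G$ that is $>1$, and $\tau_1(G)=\infty$ if there is no such root. If $\tau_1(G)<\infty$ and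 $F_G(\tau_1(G))<\infty$, put $\mathcal R(G)=\sqrt{F_G(\tau_1(G))}$; otherwise $\mathcal R(G)=\infty$. *)

(* Defs.v *)
From HB Require Import structures.
From mathcomp Require Import all_boot all_order all_algebra.
From mathcomp Require Import boolp classical_sets reals constructive_ereal.

Set Implicit Arguments.
Unset Strict Implicit.
Unset Printing Implicit Defensive.

Import Order.TTheory GRing.Theory Num.Theory.
Local Open Scope ring_scope.

Record sgraph := SGraph {
  vertex :> finType;
  edge : rel vertex;
  edge_sym : symmetric edge;
  edge_irrefl : irreflexive edge }.

Section Representations.
Variable R : realType.

(* The library norm on row vectors is the sup norm, hence this one. *)
Definition enorm (d : nat) (x : 'rV[R]_d) : R :=
  Num.sqrt (\sum_(i < d) x 0 i ^+ 2).

(* Radius 0 is allowed; this only matters for an injective image of a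
   one-vertex graph, which then lies on a sphere of R^0. *)
Definition sphere (d : nat) (c : 'rV[R]_d) (r : R) : set 'rV[R]_d :=
  [set x | enorm (x - c) = r]%classic.

Definition euclidean_rep (G : sgraph) (d : nat) (f : G -> 'rV[R]_d) : Prop :=
  injective f /\
  exists a b : R, [/\ 0 < a, a <= b,
    forall u v, edge u v -> enorm (f u - f v) = a &
    forall u v, u != v -> ~~ edge u v -> enorm (f u - f v) = b].

Definition spherical_rep (G : sgraph) (d : nat) (f : G -> 'rV[R]_d) : Prop :=
  euclidean_rep f /\
  exists (c : 'rV[R]_d) (r : R), forall v, sphere c r (f v).

Definition has_euclidean_rep (G : sgraph) : pred nat :=
  fun d => `[< exists f : G -> 'rV[R]_d, euclidean_rep f >].

Definition has_spherical_rep (G : sgraph) : pred nat :=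
  fun d => `[< exists f : G -> 'rV[R]_d, spherical_rep f >].

(* The standard basis of R^n: a regular simplex, with a = b = sqrt 2. *)
Lemma simplex_spherical_rep (G : sgraph) :
  spherical_rep (fun v : G => delta_mx 0 (enum_rank v) : 'rV[R]_#|G|).
Proof.
have dist (u v : G) : u != v ->
    enorm (delta_mx 0 (enum_rank u) - delta_mx 0 (enum_rank v)
           : 'rV[R]_#|G|) = Num.sqrt 2%:R.
  move=> uv; have ruv : enum_rank u != enum_rank v.
    by rewrite (inj_eq enum_rank_inj).
  congr Num.sqrt; rewrite (bigD1 (enum_rank u)) //=.
  rewrite (bigD1 (enum_rank v)) /=; last by rewrite eq_sym.
  rewrite big1 => [|i /andP[iu iv]]; rewrite !mxE !eqxx /=.
    by rewrite (negbTE ruv) eq_sym (negbTE ruv) subr0 sub0r sqrrN !expr1n addr0.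
  by rewrite (negbTE iu) (negbTE iv) subrr expr0n.
split; first split.
- move=> u v uv; apply/eqP; apply: contraT => /dist.
  rewrite uv subrr /enorm big1 => [/eqP|i _]; last by rewrite mxE expr0n.
  by rewrite sqrtr0 eq_sym sqrtr_eq0 lern0.
- exists (Num.sqrt 2%:R), (Num.sqrt 2%:R); split=> //.
  + by rewrite sqrtr_gt0 ltr0n.
  + move=> u v euv; apply: dist; apply: contraTneq euv => ->.
    by rewrite edge_irrefl.
  + by move=> u v uv _; exact: dist.
- exists 0, 1 => v; rewrite /sphere /= /enorm subr0.
  rewrite (bigD1 (enum_rank v)) //= big1 => [|i /negbTE iv].
    by rewrite !mxE !eqxx expr1n addr0 sqrtr1.
  by rewrite !mxE iv andbF expr0n.
Qed.

Lemma ex_spherical_rep (G : sgraph) : exists d, has_spherical_rep G d.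
Proof.
exists #|G|; apply/asboolP.
by eexists; exact: simplex_spherical_rep.
Qed.

Lemma ex_euclidean_rep (G : sgraph) : exists d, has_euclidean_rep G d.
Proof.
exists #|G|; apply/asboolP.
by eexists; exact: (proj1 (simplex_spherical_rep G)).
Qed.

Definition dim2E (G : sgraph) : nat := ex_minn (ex_euclidean_rep G).
Definition dim2S (G : sgraph) : nat := ex_minn (ex_spherical_rep G).

End Representations.

Definition two_dist_mx (G : sgraph) (A : nzRingType) (t : A) : 'M[A]_#|G| :=
  \matrix_(i, j) if i == j then 0
                 else if edge (enum_val i : G) (enum_val j) then 1 else t.

Section Circumradius.
Variables (R : realType) (G : sgraph).

Definition Mpoly : {poly R} := \det (two_dist_mx G ('X : {poly R})).

Definition Cpoly : {poly R} :=
  \det (block_mx 0 (const_mx 1)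
                 (const_mx 1) (two_dist_mx G ('X : {poly R}))
        : 'M[{poly R}]_(1 + #|G|)).

(* The rational function - M / (2 C) in lowest terms; +oo at its poles. *)
Definition Frat (t : R) : \bar R :=
  let g := gcdp Mpoly Cpoly in
  let num := Mpoly %/ g in
  let den := Cpoly %/ g in
  if root den t then +oo%E else (- 2%:R^-1 * (num.[t] / den.[t]))%:E.

Definition smallest_root_gt1 (t : R) : Prop :=
  [/\ 1 < t, root Cpoly t &
      forall s, 1 < s -> root Cpoly s -> t <= s].

Definition tau1 : \bar R :=
  xget +oo%E [set t%:E | t in [set t : R | smallest_root_gt1 t]]%classic.

Definition circumradius : \bar R :=
  if tau1 is t%:E then
    if Frat t is s%:E then (Num.sqrt s)%:E else +oo%E
  else +oo%E.

End Circumradius.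

(* Main.v *)
Require Import Defs.
From mathcomp Require Import all_boot all_order all_algebra.
From mathcomp Require Import boolp classical_sets reals constructive_ereal.
From mathcomp Require Import polyrcf.
From mathcomp Require Import ring lra.

Set Implicit Arguments.
Unset Strict Implicit.
Unset Printing Implicit Defensive.

Import Order.TTheory GRing.Theory Num.Theory.
Local Open Scope ring_scope.

(** Write [D t] for the matrix of squared distances [1] and [t], [J] for the
all-ones matrix, [M] and [C] for the determinants of [D t] and of [D t]
bordered by ones, and [n] for the number of vertices.  Up to scaling, a
representation of [G] is a choice of [t >= 1] and of points with squared
distance matrix [D t].  Such points exist exactly when the form of [D t] is
negative semidefinite on the vectors of coordinate sum [0], and they can be
put on a sphere (in the dimension they live in) exactly when [lam J - D t] is
positive semidefinite for some [lam]: for points on a sphere of radius [r]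
around the origin, [2 r^2 J - D t] is twice their Gram matrix, and conversely
semidefiniteness makes the squared norms compatible with every affine
dependency of the points ([cospherical_lift], [lift_cospherical]).

At [t = 1] the points form a regular simplex, which is spherical of dimension
[n - 1]; so both dimensions are at most [n - 1], and only representations in
fewer than [n - 1] dimensions matter.  Such a representation has an affine
dependency in excess, which makes the bordered determinant [C] vanish at [t].
On the other hand [D s] is an affine function of [s] and is strictly negative
definite on sum-zero vectors at [s = 1], hence, by convexity, on all of
[1 <= s < t], where [C] therefore does not vanish.  So [t] is the first root of
[C] beyond [1] ([sqdist_smallest_root]): the value of [t] is forced.

It remains to see that [-M/C], which is twice the squared circumradius, has no
pole at this [t] exactly when the representation is spherical
([nopole_lift_psd]).  Cramer's rule yields a vector [w] of coordinate sum [C]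
with [w D = - M 1], and testing the forms of [D s] and [lam J - D s] on [w] and
on sum-zero combinations of [w] with other vectors gives, for [1 <= s < t],
  - [-M/C] is itself a value of [lam] for which [lam J - D s] is semidefinite;
  - every such value is at least [-M/C], and [-M/C] is nonnegative.
If there is no pole, the first point passes to the limit [s -> t]; if some
[lam] works at [t], then [max lam 1] works for all [s] between [1] and [t], and
the second point bounds the fraction near [t].

Hence, if the circumradius is finite, any Euclidean representation in fewer
than [n - 1] dimensions is already spherical; and if it is infinite, none of
them is. *)

(** * Quadratic forms on vectors of coordinate sum zero *)

Section QuadraticForms.
Variables (R : realFieldType) (n : nat).
Implicit Types (A D : 'M[R]_n) (x y z : 'rV[R]_n) (a lam : R).

Definition bform A x y : R := (x *m A *m y^T) 0 0.

Definition coord_sum x : R := \sum_i x 0 i.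

Lemma mul_ones m x : x *m const_mx 1 = const_mx (coord_sum x) :> 'rV[R]_m.
Proof.
apply/rowP => j; rewrite !mxE; apply: eq_bigr => i _.
by rewrite mxE mulr1.
Qed.

Lemma coord_sumD x y : coord_sum (x + y) = coord_sum x + coord_sum y.
Proof.
by rewrite /coord_sum -big_split; apply: eq_bigr => i _; rewrite mxE.
Qed.

Lemma coord_sumZ a x : coord_sum (a *: x) = a * coord_sum x.
Proof.
by rewrite /coord_sum mulr_sumr; apply: eq_bigr => i _; rewrite mxE.
Qed.

Lemma coord_sum_delta i : coord_sum (delta_mx 0 i) = 1.
Proof.
rewrite /coord_sum (bigD1 i) //= big1 => [|j /negbTE ji].
  by rewrite mxE !eqxx addr0.
by rewrite mxE ji andbF.
Qed.

Lemma sum_sqr_gt0 x : x != 0 -> 0 < \sum_i x 0 i ^+ 2.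
Proof.
move=> x0; rewrite lt_neqAle sumr_ge0 ?andbT => [|i _]; last exact: sqr_ge0.
rewrite eq_sym psumr_neq0 => [|i _]; last exact: sqr_ge0.
apply/hasP; have [i xi] : exists i, x 0 i != 0 by apply/rV0Pn.
by exists i; rewrite ?mem_index_enum //= lt_neqAle sqr_ge0 eq_sym sqrf_eq0 xi.
Qed.

Lemma bformDl A x y z : bform A (x + y) z = bform A x z + bform A y z.
Proof. by rewrite /bform !mulmxDl mxE. Qed.

Lemma bformDr A x y z : bform A x (y + z) = bform A x y + bform A x z.
Proof. by rewrite /bform linearD mulmxDr mxE. Qed.

Lemma bformZl A a x y : bform A (a *: x) y = a * bform A x y.
Proof. by rewrite /bform -!scalemxAl mxE. Qed.

Lemma bformZr A a x y : bform A x (a *: y) = a * bform A x y.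
Proof. by rewrite /bform linearZ -scalemxAr mxE. Qed.

Lemma bformC A x y : A^T = A -> bform A x y = bform A y x.
Proof.
move=> sA; rewrite /bform -[in LHS]sA -[x in LHS]trmxK -!trmx_mul mxE.
by rewrite mulmxA.
Qed.

Lemma const_mul_tr a y : ((const_mx a : 'rV_n) *m y^T) 0 0 = a * coord_sum y.
Proof. by rewrite mxE mulr_sumr; apply: eq_bigr => i _; rewrite !mxE. Qed.

Lemma bform_mulE A x y a : x *m A = const_mx a -> bform A x y = a * coord_sum y.
Proof. by move=> xA; rewrite /bform xA const_mul_tr. Qed.

Lemma bform_delta A i j : bform A (delta_mx 0 i) (delta_mx 0 j) = A i j.
Proof. by rewrite /bform -rowE trmx_delta -colE !mxE. Qed.

(** Conditional negative (semi)definiteness, the classical criterion for a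
matrix of squared Euclidean distances. *)
Definition cond_nsd D := forall x, coord_sum x = 0 -> bform D x x <= 0.

Definition cond_nd D :=
  forall x, coord_sum x = 0 -> x != 0 -> bform D x x < 0.

(** Positive semidefiniteness of [lam J - D]: the form of [J] is the square of
the coordinate sum. *)
Definition lift_psd lam D :=
  forall x, bform D x x <= lam * coord_sum x ^+ 2.

(** A null vector of the semidefinite form [lam J - D] is orthogonal to
everything, since otherwise moving far along it would make the form
negative. *)
Lemma lift_psd_null lam D z y : D^T = D -> lift_psd lam D ->
  coord_sum z = 0 -> bform D z z = 0 -> bform D z y = 0.
Proof.
move=> sD h z0 Dz; apply/eqP; apply: contraT => b0.
set b := bform D z y in b0 *.
pose q := lam * coord_sum y ^+ 2 - bform D y y.
(* The step along z at which the form takes the value -1. *)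
have := h (y + ((q + 1) / (2 * b)) *: z).
rewrite coord_sumD coord_sumZ z0 mulr0 addr0 bformDl !bformDr !bformZl !bformZr.
rewrite Dz (bformC y z sD) -/b !mulr0 addr0.
suff -> : (q + 1) / (2 * b) * b = (q + 1) / 2 by rewrite /q; lra.
by field.
Qed.

End QuadraticForms.

(** * Cramer's rule for the bordered matrix *)

Section Bordered.
Variables (R : comNzRingType) (n : nat).

Definition bordered (D : 'M[R]_n) : 'M[R]_(1 + n) :=
  block_mx 0 (const_mx 1) (const_mx 1) D.

Lemma cofactor_bordered (D : 'M[R]_n) : cofactor (bordered D) 0 0 = \det D.
Proof.
rewrite /cofactor addn0 expr0 mul1r; congr (\det _); apply/matrixP => i j.
by rewrite 2![LHS]mxE -!rshift1 block_mxEdr.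
Qed.

End Bordered.

Section BorderedReal.
Variables (R : realFieldType) (n : nat).
Implicit Types (D : 'M[R]_n) (lam : R).

(** The vector is the first row of the adjugate without its first entry, which
is [\det D].  Using the adjugate rather than the inverse keeps the identities
valid where the bordered determinant vanishes. *)
Lemma cramer_bordered D : exists w : 'rV[R]_n,
  coord_sum w = \det (bordered D) /\ w *m D = const_mx (- \det D).
Proof.
pose r : 'rV_(1 + n) := row 0 (\adj (bordered D)).
have : r *m bordered D = \det (bordered D) *: delta_mx 0 0.
  by rewrite /r -row_mul mul_adj_mx -scalemx1 linearZ /= row1.
have r0 : lsubmx r = const_mx (\det D).
  apply/matrixP => i j; rewrite !ord1 !mxE.
  rewrite -cofactor_bordered; congr (cofactor _ _ _); exact: val_inj.
rewrite -{1}(hsubmxK r) r0 mul_row_block mulmx0 add0r => e.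
exists (rsubmx r); split.
  have := congr1 (fun u : 'rV_(1 + n) => lsubmx u 0 0) e.
  rewrite row_mxKl mul_ones mxE => ->; rewrite !mxE.
  by rewrite (_ : lshift n 0 = 0) ?eqxx ?mulr1 //; exact: val_inj.
have := congr1 (fun u : 'rV_(1 + n) => rsubmx u) e.
rewrite row_mxKr => /rowP e'; apply/rowP => j.
have := e' j; rewrite [LHS]mxE [in X in X + _]mxE big_ord1 !mxE mulr1 mulr0.
by move/eqP; rewrite addrC addr_eq0 => /eqP.
Qed.

(** Where the bordered determinant [C] is nonzero, this says that [lam J - D] is
positive semidefinite for [lam = - \det D / C].  It is the hypothesis applied
to [C *: y - coord_sum y *: w], with [w] given by Cramer's rule. *)
Lemma cond_nsd_lift D y : D^T = D -> cond_nsd D ->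
  \det (bordered D) ^+ 2 * bform D y y
    <= - (\det D * \det (bordered D)) * coord_sum y ^+ 2.
Proof.
move=> sD nD; have [w [sw wD]] := cramer_bordered D.
set C := \det (bordered D) in sw *.
have := nD (C *: y + (- coord_sum y) *: w).
rewrite coord_sumD !coord_sumZ sw bformDl !bformDr !bformZl !bformZr.
rewrite (bformC y w sD) !(bform_mulE _ wD) sw.
have -> : C * coord_sum y + - coord_sum y * C = 0 by ring.
by move=> /(_ erefl); lra.
Qed.

(** Where the bordered determinant [C] is nonzero, [- \det D / C] is a lower
bound for the possible [lam]: test the form on the vector [w] of Cramer's
rule. *)
Lemma lift_psd_bound D lam : lift_psd lam D ->
  - (\det D * \det (bordered D)) <= lam * \det (bordered D) ^+ 2.
Proof.
have [w [sw wD]] := cramer_bordered D => /(_ w).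
by rewrite (bform_mulE _ wD) sw mulNr.
Qed.

(** If [(a, x)] is a null vector of the bordered matrix, then [x] has coordinate
sum [0] and [x D = - a 1], so the form of [D] vanishes at [x]. *)
Lemma det_bordered_neq0 D : (0 < n)%N -> cond_nd D -> \det (bordered D) != 0.
Proof.
move=> n0 nD; apply/negP => /det0P [v v0 vB].
have := vB; rewrite -(hsubmxK v) mul_row_block mulmx0 add0r.
rewrite -{1}(row_mx0 R 1 1 n) => /eq_row_mx [].
rewrite mul_ones => /rowP/(_ 0); rewrite !mxE => sx e.
have xD : rsubmx v *m D = const_mx (- v 0 0).
  apply/rowP => j; have /rowP/(_ j) := e; rewrite [LHS]mxE [in X in X + _]mxE.
  rewrite big_ord1 !mxE mulr1 (_ : lshift n 0 = 0); last exact: val_inj.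
  by move/eqP; rewrite addrC addr_eq0 => /eqP.
have x0 : rsubmx v = 0.
  apply/eqP; apply: contraT => x0.
  by have := nD _ sx x0; rewrite (bform_mulE _ xD) sx mulr0 ltxx.
case/negP: v0; rewrite -(hsubmxK v) x0.
have /rowP/(_ (Ordinal n0)) := xD; rewrite x0 mul0mx !mxE => /esym/eqP.
rewrite oppr_eq0 => /eqP v00; suff -> : lsubmx v = 0 by rewrite row_mx0.
apply/rowP => j; rewrite ord1 !mxE -[RHS]v00; congr (v _ _); exact: val_inj.
Qed.

End BorderedReal.

(** * Squared distance matrices and cospherical points *)

Section Configurations.
Variables (R : realFieldType) (n d : nat).
Implicit Types (X : 'M[R]_(n, d)) (c : 'rV[R]_d) (z : 'rV[R]_n).

Definition sqdist_mx X : 'M[R]_n :=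
  \matrix_(i, j) \sum_k (X i k - X j k) ^+ 2.

Definition cospherical X :=
  exists c (rho : R), forall i, \sum_k (X i k - c 0 k) ^+ 2 = rho.

Definition sqnorms X : 'cV[R]_n := \col_i \sum_k X i k ^+ 2.

Lemma sqdist_mxE X : sqdist_mx X =
  sqnorms X *m const_mx 1 + const_mx 1 *m (sqnorms X)^T
    - 2 *: (X *m X^T).
Proof.
apply/matrixP => i j; rewrite !mxE !big_ord1 !mxE mulr1 mul1r.
rewrite -big_split mulr_sumr -sumrB; apply: eq_bigr => k _.
by rewrite !mxE /=; ring.
Qed.

Lemma sqdist_mx_sym X : (sqdist_mx X)^T = sqdist_mx X.
Proof.
apply/matrixP => i j; rewrite !mxE; apply: eq_bigr => k _.
by rewrite -sqrrN opprB.
Qed.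

Lemma mul_sqdist X z : coord_sum z = 0 ->
  z *m sqdist_mx X =
    const_mx ((z *m sqnorms X) 0 0) - 2 *: (z *m X *m X^T).
Proof.
move=> z0; rewrite sqdist_mxE mulmxBr mulmxDr -scalemxAr !mulmxA.
rewrite (mul_ones _ z) z0.
have -> : const_mx 0 = 0 :> 'rV[R]_1 by apply/rowP => j; rewrite !mxE.
rewrite mul0mx addr0; congr (_ - _).
by apply/rowP => j; rewrite [LHS]mxE big_ord1 [X in _ * X]mxE mulr1 [RHS]mxE.
Qed.

Lemma bform_sqdist X z : coord_sum z = 0 ->
  bform (sqdist_mx X) z z = - 2 * \sum_k (z *m X) 0 k ^+ 2.
Proof.
move=> z0; rewrite /bform (mul_sqdist _ z0) mulmxBl mxE.
have -> : ((const_mx ((z *m sqnorms X) 0 0) : 'rV_n) *m z^T) 0 0 = 0.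
  by rewrite const_mul_tr z0 mulr0.
rewrite add0r -scalemxAl [LHS]mxE [X in - X]mxE mulNr; congr (- (2 * _)).
rewrite -[_ *m z^T]mulmxA -trmx_mul mxE; apply: eq_bigr => k _.
by rewrite [_^T _ _]mxE expr2.
Qed.

Lemma sqdist_cond_nsd X : cond_nsd (sqdist_mx X).
Proof.
move=> z z0; rewrite bform_sqdist // mulNr oppr_le0 mulr_ge0 //.
apply: sumr_ge0 => k _; exact: sqr_ge0.
Qed.

Lemma mul_sqdist_ker X z : coord_sum z = 0 -> z *m X = 0 ->
  z *m sqdist_mx X = const_mx ((z *m sqnorms X) 0 0).
Proof.
by move=> z0 zX; rewrite mul_sqdist // zX mul0mx scaler0 subr0.
Qed.

(** With the origin at the centre, [2 rho J - D] is twice the Gram matrix. *)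
Lemma cospherical_lift X :
  cospherical X -> exists lam, lift_psd lam (sqdist_mx X).
Proof.
move=> [c [rho h]]; exists (2 * rho) => x.
pose Y := \matrix_(i, k) (X i k - c 0 k).
have -> : sqdist_mx X = const_mx (2 * rho) - 2 *: (Y *m Y^T).
  apply/matrixP => i j; rewrite !mxE mulr_natl mulr2n -{1}(h i) -(h j).
  rewrite -big_split mulr_sumr -sumrB; apply: eq_bigr => k _.
  by rewrite !mxE /=; ring.
have xc : x *m const_mx (2 * rho) = const_mx (2 * rho * coord_sum x) :> 'rV_n.
  apply/rowP => j; rewrite !mxE mulr_sumr; apply: eq_bigr => i _.
  by rewrite !mxE mulrC.
rewrite /bform mulmxBr mulmxBl mxE -/(bform _ x x) (bform_mulE _ xc).
rewrite expr2 mulrA gerDl -scalemxAr -scalemxAl 2!mxE oppr_le0 mulr_ge0 //.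
rewrite mulmxA -[_ *m x^T]mulmxA -trmx_mul mxE sumr_ge0 // => k _.
by rewrite [_^T _ _]mxE -expr2 sqr_ge0.
Qed.

(** The points are cospherical as soon as their squared norms are an affine
function of the points, and by duality this only has to be tested against the
affine dependencies [z] of the points.  Such a [z] is a null vector of the
semidefinite form, and orthogonality to the unit vectors says exactly that the
squared norms satisfy the same dependency. *)
Lemma lift_cospherical X lam :
  lift_psd lam (sqdist_mx X) -> cospherical X.
Proof.
move=> h.
pose B := col_mx X^T (const_mx 1 : 'rV_n).
have : ((sqnorms X)^T <= B)%MS.
  rewrite submxE; apply/eqP/rowP => j; rewrite [RHS]mxE.
  pose z : 'rV_n := (col j (cokermx B))^T.
  have Bz : B *m col j (cokermx B) = 0.
    by rewrite colE mulmxA mulmx_coker mul0mx.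
  move: Bz; rewrite mul_col_mx -[0 in RHS](col_mx0 R d 1 1).
  move=> /eq_col_mx [Xz z1].
  have zX : z *m X = 0 by rewrite -[X]trmxK -trmx_mul Xz trmx0.
  have z0 : coord_sum z = 0.
    move/rowP/(_ 0): z1; rewrite !mxE => <-; apply: eq_bigr => i _.
    by rewrite !mxE mul1r.
  have zD := mul_sqdist_ker z0 zX.
  have Dz : bform (sqdist_mx X) z z = 0 by rewrite (bform_mulE _ zD) z0 mulr0.
  rewrite -[LHS]/((_ *m cokermx B) 0 j).
  have -> : ((sqnorms X)^T *m cokermx B) 0 j = (z *m sqnorms X) 0 0.
    by rewrite !mxE; apply: eq_bigr => i _; rewrite !mxE mulrC.
  case: (posnP n) => [n0|n0].
    rewrite mxE big1 // => -[i ilt]; exfalso; move: ilt.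
    by rewrite [X in (_ < X)%N]n0 ltn0.
  have := lift_psd_null (delta_mx 0 (Ordinal n0)) (sqdist_mx_sym X) h z0 Dz.
  by rewrite (bform_mulE _ zD) coord_sum_delta mulr1.
case/submxP => u; rewrite -(hsubmxK u) mul_row_col.
move: (lsubmx u) (rsubmx u) => c k e.
exists (2^-1 *: c), (k 0 0 + \sum_j (c 0 j / 2) ^+ 2) => i.
have := congr1 (fun v : 'rV_n => v 0 i) e.
rewrite !mxE big_ord1 !mxE mulr1 => e'.
transitivity (\sum_j X i j ^+ 2 - \sum_j c 0 j * X^T j i
              + \sum_j (c 0 j / 2) ^+ 2).
  rewrite -sumrB -big_split; apply: eq_bigr => j _; rewrite !mxE /=; by field.
by rewrite e'; ring.
Qed.

(** Fewer than [n - 1] dimensions leave room for an affine dependency, which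
yields a null vector of the bordered matrix. *)
Lemma det_bordered_sqdist X : (d.+1 < n)%N -> \det (bordered (sqdist_mx X)) = 0.
Proof.
move=> dn.
have : kermx (row_mx X (const_mx 1 : 'cV_n)) != 0.
  rewrite kermx_eq0 /row_free neq_ltn; apply/orP; left.
  by apply: leq_ltn_trans (rank_leq_col _) _; rewrite addn1.
case/rowV0Pn => z /sub_kermxP; rewrite mul_mx_row -(row_mx0 R 1 d 1).
case/eq_row_mx => zX; rewrite mul_ones => /rowP/(_ 0); rewrite !mxE => z0 nz.
apply/eqP/det0P.
exists (row_mx (const_mx (- (z *m sqnorms X) 0 0) : 'rV_1) z).
  apply: contra nz => /eqP; rewrite -(row_mx0 R 1 1 n) => /eq_row_mx [_ ->].
  by rewrite eqxx.
rewrite mul_row_block mulmx0 add0r mul_ones z0 (mul_sqdist_ker z0 zX).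
rewrite -(row_mx0 R 1 1 n); congr row_mx; apply/rowP => j; rewrite !mxE //.
by rewrite big_ord1 !mxE mulr1 addNr.
Qed.

End Configurations.

(** * The pencil of two-distance matrices *)

Lemma horner_ge0_left (R : rcfType) (p : {poly R}) (a t : R) : a < t ->
  (forall s, a <= s -> s < t -> 0 <= p.[s]) -> 0 <= p.[t].
Proof.
move=> at_ h; rewrite leNgt; apply/negP => pt.
have [d d0 hd] := poly_cont t p (ltac:(by rewrite oppr_gt0) : 0 < - p.[t]).
pose s := Num.max a (t - d / 2).
have st : s < t by rewrite gt_max at_ /=; lra.
have sd : t - d / 2 <= s by rewrite le_max lexx orbT.
have := hd s; rewrite ltr0_norm ?subr_lt0 // => /(_ ltac:(lra)) /ltr_normlP [_].
have : 0 <= p.[s] by apply: h => //; rewrite le_max lexx.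
lra.
Qed.

Section TwoDistance.
Variables (R : realType) (G : sgraph).
Implicit Types (s t lam : R) (x y : 'rV[R]_#|G|).

Local Notation D := (two_dist_mx G).
Local Notation M := (Mpoly R G).
Local Notation C := (Cpoly R G).

Lemma two_dist_mx_sym t : (D t)^T = D t.
Proof. by apply/matrixP => i j; rewrite !mxE eq_sym edge_sym. Qed.

(** The form is affine in [t], and [D 1 = J - 1%:M]. *)
Lemma bform_two_dist x : exists c, forall t, bform (D t) x x =
  coord_sum x ^+ 2 - \sum_i x 0 i ^+ 2 + (t - 1) * c.
Proof.
pose N : 'M[R]_#|G| :=
  \matrix_(i, j) ((i != j) && ~~ edge (enum_val i : G) (enum_val j))%:R.
exists (bform N x x) => t.
have -> : D t = const_mx 1 - 1%:M + (t - 1) *: N.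
  apply/matrixP => i j; rewrite !mxE; case: eqP => _ /=; first by ring.
  by case: edge => /=; ring.
have entry (U V W : 'M[R]_1) a :
  (U - V + a *: W) 0 0 = U 0 0 - V 0 0 + a * W 0 0.
  by rewrite !mxE.
rewrite /bform mulmxDr mulmxBr mulmxDl mulmxBl -scalemxAr -scalemxAl entry.
congr (_ - _ + _); first by rewrite mul_ones const_mul_tr expr2.
by rewrite mulmx1 mxE; apply: eq_bigr => i _; rewrite mxE expr2.
Qed.

Lemma two_dist1_cond_nd : cond_nd (D (1 : R)).
Proof.
move=> x x0 nx; have [c ->] := bform_two_dist x; have := sum_sqr_gt0 nx.
by rewrite x0 subrr mul0r; lra.
Qed.

(** [D s] is a convex combination of [D t] and of the definite [D 1], the latter
with positive weight. *)
Lemma two_dist_cond_nd s t : 1 <= s -> s < t -> cond_nsd (D t) -> cond_nd (D s).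
Proof.
move=> s1 st nD x x0 nx; have := nD x x0; have := sum_sqr_gt0 nx.
have [c h] := bform_two_dist x; rewrite !h x0.
by have [c0|c0] := lerP c 0; nra.
Qed.

(** The same convexity argument; [lam J - D 1] is semidefinite as soon as
[1 <= lam], whence the maximum. *)
Lemma two_dist_lift_psd s t lam : 1 <= s -> s <= t ->
  lift_psd lam (D t) -> lift_psd (Num.max lam 1) (D s).
Proof.
move=> s1 st h x; have := h x; have [c e] := bform_two_dist x; rewrite !e.
set S := \sum_i _; have S0 : 0 <= S by apply: sumr_ge0 => i _; exact: sqr_ge0.
have := sqr_ge0 (coord_sum x); set u := coord_sum x ^+ 2 => u0 hx.
have l1 : u <= Num.max lam 1 * u by rewrite ler_peMl // le_max lexx orbT.
have l2 : lam * u <= Num.max lam 1 * u by rewrite ler_wpM2r // le_max lexx.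
by have [c0|c0] := lerP c 0; nra.
Qed.

Lemma map_two_dist t : map_mx (horner_eval t) (D ('X : {poly R})) = D t.
Proof.
apply/matrixP => i j; rewrite !mxE /horner_eval.
case: eqP => _; first by rewrite horner0.
by case: edge; rewrite ?hornerX // hornerC.
Qed.

Lemma horner_Mpoly t : M.[t] = \det (D t).
Proof. by rewrite -horner_evalE -det_map_mx map_two_dist. Qed.

Lemma horner_Cpoly t : C.[t] = \det (bordered (D t)).
Proof.
rewrite -horner_evalE -det_map_mx map_block_mx map_two_dist !map_const_mx.
by rewrite rmorph0 rmorph1.
Qed.

(** Few dimensions make [C] vanish at [t], and strict definiteness keeps it from
vanishing at any [s] with [1 <= s < t]. *)
Lemma sqdist_smallest_root d (X : 'M[R]_(#|G|, d)) t : (d.+1 < #|G|)%N ->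
  1 <= t -> sqdist_mx X = D t -> smallest_root_gt1 G t.
Proof.
move=> dn t1 XD; have n0 := leq_ltn_trans (leq0n _) dn.
have rt : root C t by rewrite rootE horner_Cpoly -XD det_bordered_sqdist.
split=> //.
  rewrite lt_neqAle t1 andbT; apply/negP => /eqP e.
  have := det_bordered_neq0 n0 two_dist1_cond_nd.
  by rewrite -horner_Cpoly e -rootE rt.
move=> s s1 rs; rewrite leNgt; apply/negP => st.
have nD : cond_nsd (D t) by rewrite -XD; exact: sqdist_cond_nsd.
have := det_bordered_neq0 n0 (two_dist_cond_nd (ltW s1) st nD).
by rewrite -horner_Cpoly -rootE rs.
Qed.

(** For [1 <= s < t], the quotient [- M.[s] / C.[s]] is the smallest [lam]
making [lam J - D s] semidefinite, and it is nonnegative.  If the quotient has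
no pole at [t], then its value there works for [D t], as a limit of
semidefinite forms is semidefinite.  If some [lam] works for [D t], then the
quotient is squeezed between [0] and a constant on the left of [t], and a
reduced fraction that stays bounded has no pole. *)
Lemma nopole_lift_psd t : (0 < #|G|)%N -> smallest_root_gt1 G t ->
  cond_nsd (D t) ->
  ~~ root (C %/ gcdp M C) t <-> exists lam, lift_psd lam (D t).
Proof.
move=> n0 [t1 rt _] nD.
have nd s : 1 <= s -> s < t -> cond_nd (D s).
  by move=> s1 st; exact: two_dist_cond_nd nD.
have nsd s : 1 <= s -> s < t -> cond_nsd (D s).
  move=> s1 st x x0; have [->|nx] := eqVneq x 0; last exact/ltW/nd.
  by rewrite /bform mul0mx mul0mx mxE.
have Cs s : 1 <= s -> s < t -> C.[s] != 0.
  move=> s1 st; rewrite horner_Cpoly.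
  exact: det_bordered_neq0 n0 (nd s s1 st).
have C0 : C != 0 by apply: contraNneq (Cs 1 (lexx 1) t1) => ->; rewrite horner0.
set g := gcdp M C; pose num := M %/ g; pose den := C %/ g.
rewrite -/den.
have eM s : M.[s] = num.[s] * g.[s] by rewrite -hornerM divpK // dvdp_gcdl.
have eC s : C.[s] = den.[s] * g.[s] by rewrite -hornerM divpK // dvdp_gcdr.
have cop : coprimep den num.
  by rewrite coprimep_sym; apply: coprimep_div_gcd; rewrite C0 orbT.
have gs s : 1 <= s -> s < t -> 0 < g.[s] ^+ 2.
  move=> s1 st; rewrite exprn_even_gt0 //=; apply: contraNneq (Cs s s1 st) => e.
  by rewrite eC e mulr0.
split=> [dt|[lam h]].
  exists (- (num.[t] / den.[t])) => y; have [c e] := bform_two_dist y.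
  rewrite e; set S := \sum_i _ in e *; set u := coord_sum y ^+ 2 in e *.
  (* The form of lam J - D s at y, for lam = - num/den, times den^2: a
     polynomial in s that is nonnegative for 1 <= s < t. *)
  pose q := - (num * den) * u%:P - den ^+ 2 * ((u - S)%:P + ('X - 1%:P) * c%:P).
  have qE s : q.[s] = - (num.[s] * den.[s]) * u
      - den.[s] ^+ 2 * (u - S + (s - 1) * c).
    by rewrite /q !(hornerD, hornerN, hornerM, hornerC, hornerX, horner_exp).
  have : 0 <= q.[t].
    apply: (horner_ge0_left t1) => s s1 st.
    rewrite -(pmulr_lge0 _ (gs s s1 st)).
    have := cond_nsd_lift y (two_dist_mx_sym s) (nsd s s1 st).
    rewrite -horner_Cpoly -horner_Mpoly e -/u eM eC qE -subr_ge0.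
    by congr (0 <= _); ring.
  rewrite qE => qt.
  have d0 : den.[t] != 0 by rewrite -rootE.
  have d2 : 0 < den.[t] ^+ 2 by rewrite exprn_even_gt0.
  rewrite -(ler_pM2l d2) -subr_ge0; move: qt; congr (0 <= _).
  by field.
apply/negP => rd.
pose l := Num.max lam 1.
(* Nonnegativity of q expresses that num/den is bounded by l in absolute
   value. *)
pose q := (l ^+ 2)%:P * den ^+ 2 - num ^+ 2.
have qE s : q.[s] = l ^+ 2 * den.[s] ^+ 2 - num.[s] ^+ 2.
  by rewrite /q !(hornerD, hornerN, hornerM, hornerC, horner_exp).
have : 0 <= q.[t].
  apply: (horner_ge0_left t1) => s s1 st.
  have hs := two_dist_lift_psd s1 (ltW st) h.
  have up := lift_psd_bound hs.
  (* The diagonal of D s is zero, so a unit vector gives 0 <= - M/C. *)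
  have lo := cond_nsd_lift (delta_mx 0 (Ordinal n0))
    (two_dist_mx_sym s) (nsd s s1 st).
  rewrite bform_delta mxE eqxx mulr0 coord_sum_delta expr1n mulr1 in lo.
  move: up lo; rewrite -horner_Cpoly -horner_Mpoly -/l.
  have : 0 < C.[s] ^+ 2 by rewrite exprn_even_gt0 //=; exact: Cs.
  move: (gs s s1 st); rewrite qE eM eC.
  set a := num.[s]; set b := den.[s]; set k := g.[s] => k0 bk0 up lo.
  have b0 : 0 < b ^+ 2 by move: bk0; rewrite exprMn pmulr_lgt0.
  have up' : - (a * b) <= l * b ^+ 2.
    by rewrite -(ler_pM2r k0); lra.
  have lo' : 0 <= - (a * b) by rewrite -(pmulr_lge0 _ k0); lra.
  rewrite subr_ge0 -(ler_pM2r b0).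
  by have := ler_pM lo' lo' up' up'; lra.
rewrite qE.
have /eqP -> := rd; rewrite expr0n mulr0 add0r oppr_ge0 => n2.
have := coprimep_root cop rd; rewrite -sqrf_eq0 eq_le n2 sqr_ge0.
by [].
Qed.

Lemma circumradius_lty t : smallest_root_gt1 G t ->
  (circumradius R G < +oo)%E = ~~ root (C %/ gcdp M C) t.
Proof.
move=> ht; rewrite /circumradius.
have -> : tau1 R G = t%:E.
  apply: xget_unique; first by exists t.
  move=> _ [u hu <-]; congr (_%:E); apply/le_anti.
  by case: ht hu => t1 rt mt [u1 ru mu]; rewrite mt // mu.
by rewrite /Frat; case: ifP => _; rewrite ?ltxx ?ltry.
Qed.

(** The circumradius only depends on [G], yet it decides whether a given
low-dimensional configuration is cospherical, because the value of [t] of such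
a configuration is forced to be the root that defines the circumradius. *)
Lemma sqdist_circumradius d (X : 'M[R]_(#|G|, d)) t : (d.+1 < #|G|)%N ->
  1 <= t -> sqdist_mx X = D t ->
  (circumradius R G < +oo)%E <-> cospherical X.
Proof.
move=> dn t1 XD; have ht := sqdist_smallest_root dn t1 XD.
rewrite (circumradius_lty ht).
have n0 := leq_ltn_trans (leq0n _) dn.
have nD : cond_nsd (D t) by rewrite -XD; exact: sqdist_cond_nsd.
rewrite (nopole_lift_psd n0 ht nD) -XD; split; last exact: cospherical_lift.
by case=> lam; exact: lift_cospherical.
Qed.

End TwoDistance.

(** * The regular simplex *)

(** The unit vectors of dimension [m = n - 1], together with the point all of
whose coordinates are [al], scaled to edge length [1].  The point is at
distance [sqrt 2] from the unit vectors when [m al^2 - 2 al - 1 = 0]; the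
chosen root is the one that exists for [m = 0] as well. *)
Lemma regular_simplex (R : rcfType) n :
  exists X : 'M[R]_(n, n.-1), sqdist_mx X = const_mx 1 - 1%:M.
Proof.
case: n => [|m]; first by exists 0; apply/matrixP => -[].
pose r : R := Num.sqrt m.+1%:R; pose al : R := - (1 + r)^-1.
have r2 : r ^+ 2 = m%:R + 1 by rewrite sqr_sqrtr ?ler0n // -natr1.
have r0 : 1 + r != 0 by rewrite gt_eqF // ltr_wpDr ?ltr01 ?sqrtr_ge0.
have alE : m%:R * al ^+ 2 = 1 + 2 * al.
  have -> : m%:R = r ^+ 2 - 1 by rewrite r2 addrK.
  by rewrite /al; field.
pose s : R := Num.sqrt 2^-1.
have s2 : s ^+ 2 = 2^-1 by rewrite sqr_sqrtr ?invr_ge0 ?ler0n.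
have unit_sum (j : 'I_m) : \sum_k (j == k)%:R = 1 :> R.
  rewrite (bigD1 j) //= eqxx big1 ?addr0 // => k.
  by rewrite eq_sym => /negbTE ->.
have apex (j : 'I_m) : \sum_k ((j == k)%:R - al) ^+ 2 = 2.
  transitivity (\sum_k ((j == k)%:R * (1 - 2 * al) + al ^+ 2)).
    by apply: eq_bigr => k _; case: (j == k) => /=; ring.
  rewrite big_split /= -mulr_suml unit_sum sumr_const card_ord.
  rewrite -[X in _ + X]mulr_natl alE.
  ring.
exists (\matrix_(i, k)
  (s * if unlift ord0 i is Some j then (j == k)%:R else al)).
apply/matrixP => i j; rewrite !mxE.
under eq_bigr => k _ do rewrite !mxE -mulrBr exprMn s2.
rewrite -mulr_sumr; have [i' ->|->] := unliftP; have [j' ->|->] := unliftP.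
- rewrite (inj_eq lift_inj); have [->|ij] := eqVneq i' j'.
    by rewrite big1 ?mulr0 ?subrr // => k _; rewrite subrr expr0n.
  rewrite subr0 (eq_bigr (fun k => (i' == k)%:R + (j' == k)%:R)).
    by rewrite big_split /= !unit_sum; field.
  move=> k _; have [ik|_] := eqVneq i' k.
    by rewrite -ik [j' == _]eq_sym (negbTE ij) subr0 expr1n addr0.
  by rewrite sub0r sqrrN add0r; case: (j' == k); rewrite ?expr1n ?expr0n.
- by rewrite apex eq_sym (negbTE (neq_lift _ _)) subr0 mulVf ?pnatr_eq0.
- under eq_bigr => k _ do rewrite -sqrrN opprB.
  by rewrite apex (negbTE (neq_lift _ _)) subr0 mulVf ?pnatr_eq0.
- rewrite big1 => [|k _]; first by rewrite eqxx subrr mulr0.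
  by rewrite subrr expr0n.
Qed.

(** * Representations as point configurations *)

Section Representations.
Variables (R : realType) (G : sgraph).

Local Notation D := (two_dist_mx G).

Lemma sqr_enorm d (x : 'rV[R]_d) : enorm x ^+ 2 = \sum_k x 0 k ^+ 2.
Proof. by rewrite sqr_sqrtr // sumr_ge0 // => k _; exact: sqr_ge0. Qed.

(** Dividing by [a] turns the two squared distances into [1] and
[t = (b / a) ^+ 2]; a complete graph leaves [b], hence [t], arbitrary. *)
Lemma euclidean_rep_sqdist d (f : G -> 'rV[R]_d) : euclidean_rep f ->
  exists (X : 'M[R]_(#|G|, d)) t, [/\ 1 <= t, sqdist_mx X = D t &
    spherical_rep f -> cospherical X].
Proof.
move=> [_ [a [b [a0 ab fa fb]]]].
have an0 : a != 0 by rewrite gt_eqF.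
pose X := \matrix_(i < #|G|, k < d) (f (enum_val i) 0 k / a).
exists X, ((b / a) ^+ 2); split.
- by rewrite exprn_ege1 // ler_pdivlMr // mul1r.
- apply/matrixP => i j; rewrite !mxE.
  have -> : \sum_k (X i k - X j k) ^+ 2
      = (enorm (f (enum_val i) - f (enum_val j)) / a) ^+ 2.
    rewrite exprMn sqr_enorm mulr_suml; apply: eq_bigr => k _.
    by rewrite !mxE -mulrBl exprMn.
  have [->|ij] := eqVneq i j.
    rewrite exprMn sqr_enorm big1 ?mul0r // => k _.
    by rewrite !mxE subrr expr0n.
  case: ifP => e; first by rewrite fa // divff // expr1n.
  by rewrite fb ?e // (inj_eq enum_val_inj).
- move=> [_ [c [r h]]]; exists (a^-1 *: c), ((r / a) ^+ 2) => i.
  rewrite -(h (enum_val i)) exprMn sqr_enorm mulr_suml; apply: eq_bigr => k _.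
  by rewrite !mxE -exprMn; congr (_ ^+ 2); ring.
Qed.

Lemma sqdist_spherical_rep d (X : 'M[R]_(#|G|, d)) t : 1 <= t ->
  sqdist_mx X = D t -> cospherical X ->
  spherical_rep (fun v : G => row (enum_rank v) X).
Proof.
move=> t1 XD [c [rho h]].
have fE u v : enorm (row (enum_rank u) X - row (enum_rank v) X)
    = Num.sqrt (D t (enum_rank u) (enum_rank v)).
  rewrite -XD mxE; congr Num.sqrt; apply: eq_bigr => k _; by rewrite !mxE.
have dist u v : u != v -> enorm (row (enum_rank u) X - row (enum_rank v) X)
    = if edge u v then 1 else Num.sqrt t.
  move=> uv; rewrite fE mxE (inj_eq enum_rank_inj) (negbTE uv) !enum_rankK.
  by case: edge; rewrite ?sqrtr1.
have st : 1 <= Num.sqrt t by rewrite -sqrtr1 ler_wsqrtr.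
split; [split|].
- move=> u v uv; apply/eqP; apply: contraT => nuv.
  have := dist u v nuv; rewrite /= in uv.
  rewrite uv subrr /enorm big1 => [|k _].
    by rewrite sqrtr0 => e; case: edge e => e; lra.
  by rewrite mxE expr0n.
- exists 1, (Num.sqrt t); split=> // [u v uv|u v uv /negbTE e].
    rewrite dist ?uv //; apply: contraTneq uv => ->; by rewrite edge_irrefl.
  by rewrite dist // e.
- exists c, (Num.sqrt rho) => v; rewrite /sphere /= -(h (enum_rank v)).
  by congr Num.sqrt; apply: eq_bigr => k _; rewrite !mxE.
Qed.

Lemma has_spherical_rep_simplex : has_spherical_rep R G #|G|.-1.
Proof.
have [X XE] := regular_simplex R #|G|.
have XD : sqdist_mx X = D 1.
  apply/matrixP => i j; rewrite XE !mxE.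
  by case: eqP => _; rewrite ?subrr // subr0; case: edge.
apply/asboolP; exists (fun v => row (enum_rank v) X).
apply: (sqdist_spherical_rep (lexx 1) XD).
apply: (@lift_cospherical _ _ _ _ 1) => x; rewrite XD.
have [c ->] := bform_two_dist x.
rewrite subrr mul0r addr0 mul1r gerBl sumr_ge0 // => i _; exact: sqr_ge0.
Qed.

End Representations.

Theorem theorem3p1 (R : realType) (G : sgraph) (n : nat) (hn : #|G| = n) :
  dim2S R G = (if (circumradius R G < +oo)%E then dim2E R G else n - 1)%N.
Proof.
rewrite -hn subn1 /dim2S /dim2E.
case: ex_minnP => dS /asboolP[f fS] minS.
case: ex_minnP => dE /asboolP[h hE] minE.
have dSn : (dS <= #|G|.-1)%N by apply: minS; exact: has_spherical_rep_simplex.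
have dES : (dE <= dS)%N by apply: minE; apply/asboolP; exists f; case: fS.
case: ifPn => fin; apply/eqP; rewrite eqn_leq.
- rewrite dES andbT; have [dn|] := ltnP dE #|G|.-1; last exact: leq_trans.
  have [X [t [t1 XD _]]] := euclidean_rep_sqdist hE.
  have dn' : (dE.+1 < #|G|)%N by rewrite -ltn_predRL.
  apply: minS; apply/asboolP; exists (fun v => row (enum_rank v) X).
  apply: (sqdist_spherical_rep t1 XD).
  exact/(sqdist_circumradius dn' t1 XD).
- rewrite dSn leqNgt /=; apply: contra fin => dn.
  have [X [t [t1 XD cX]]] := euclidean_rep_sqdist fS.1.
  have dn' : (dS.+1 < #|G|)%N by rewrite -ltn_predRL.
  by apply/(sqdist_circumradius dn' t1 XD); exact: cX.
Qed.
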